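(* Let $T:\mathcal H\rightrightarrows\mathcal H$ be a monotone mapping, let $c>0$, and let $B$ be aligned with the splitting $\mathcal H=H_*\oplus H_{**}$. For $z,x\in\mathcal H$, write $z=(z_*,z_{**})$ and $x=(x_*,x_{**})$. Then the following are equivalent: (a) The full-space inclusion holds: $0\in T(z)+c^{-1}B(z-x)$, or equivalently $z\in(B+cT)^{-1}Bx$. (b) The active and completion relations hold: $$0\in T_*(z_* )+c^{-1}B_*(z_*-x_* ),\qquad z_{**}\in T_{**}\bigl(z_*,-c^{-1}B_*(z_*-x_* )\bigr).$$ Moreover, the active relation $0\in T_*(z_* )+c^{-1}B_*(z_*-x_* )$ is equivalent to $z_*\in(I+cB_*^{-1}T_* )^{-1}x_*$.
   Context: $\mathcal H$ is a finite-dimensional Hilbert space with an orthogonal decomposition (splitting) $\mathcal H=H_*\oplus H_{**}$ into subspaces; each $z\in\mathcal H$ is written $z=z_*+z_{**}=(z_*,z_{**})$ with $z_*\in H_*$, $z_{**}\in H_{**}$ its orthogonal components. A self-adjoint positive semidefinite linear operator $B:\mathcal H\to\mathcal H$ is aligned with the splitting if its range is $H_*$ and its kernel is $H_{**}$; then $B_*:=B|_{H_*}:H_*\to H_*$ is self-adjoint positive definite and $B(z_*,z_{**})=(B_*z_*,0)$. Given $T:\mathcal H\rightrightarrows\mathcal H$, the projected mapping $T_*:H_*\rightrightarrows H_*$ and the completion mapping $T_{**}:H_*\times H_*\rightrightarrows H_{**}$ are defined by $$w_*\in T_*(z_* )\iff\exists z_{**}\in H_{**}\text{ such that }(w_*,0)\in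 T(z_*,z_{**}),$$ $$T_{**}(z_*,w_* ):=\{z_{**}\in H_{**}\mid(w_*,0)\in T(z_*,z_{**})\}.$$ Inverses of set-valued mappings are graph inverses. *)

(* Defs.v *)
From mathcomp Require Import all_boot all_order all_algebra.
From mathcomp Require Import all_classical reals.

Set Implicit Arguments.
Unset Strict Implicit.
Unset Printing Implicit Defensive.

Import Order.TTheory GRing.Theory Num.Theory.

Local Open Scope classical_set_scope.
Local Open Scope ring_scope.

(* Set-valued mappings [U ⇉ V] are functions [U -> set V]; [T z w] reads
   [w ∈ T(z)]. A finite-dimensional (real) Hilbert space is a [vectType] over
   [R : realType] with a positive definite symmetric form
   [dot : {dot H for idfun}]. *)

Definition graph_inv (U V : Type) (T : U -> set V) : V -> set U :=
  fun w => [set z | T z w].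

Section Hilbert.
Variables (R : realType) (H : vectType R) (dot : {dot H for idfun}).

Definition monotone_map (T : H -> set H) : Prop :=
  forall z1 z2 w1 w2, T z1 w1 -> T z2 w2 -> 0 <= dot (w1 - w2) (z1 - z2).

Definition self_adjoint (B : 'End(H)) : Prop :=
  forall u v, dot (B u) v = dot u (B v).

Definition pos_semidef (B : 'End(H)) : Prop := forall u, 0 <= dot (B u) u.

(* Orthogonality makes the sum direct. *)
Definition orth_splitting (Hs Hss : {vspace H}) : Prop :=
  (Hs + Hss = fullv)%VS /\ (Hs <= orthov dot Hss)%VS.

Definition aligned (Hs Hss : {vspace H}) (B : 'End(H)) : Prop :=
  [/\ self_adjoint B, pos_semidef B, limg B = Hs & lker B = Hss].

End Hilbert.

Section Splitting.
Variables (R : realType) (H : vectType R) (Hs Hss : {vspace H}).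

(* Components of [z] along [Hs] and [Hss]. [vsproj Hs] alone would project
   along the arbitrary complement [Hs^C], not along [Hss]. *)
Definition star_part (z : H) : subvs_of Hs := vsproj Hs (daddv_pi Hs Hss z).
Definition sstar_part (z : H) : subvs_of Hss := vsproj Hss (daddv_pi Hss Hs z).

(* The element [(zs, zss)] of [H = Hs ⊕ Hss]. *)
Definition recompose (zs : subvs_of Hs) (zss : subvs_of Hss) : H :=
  vsval zs + vsval zss.

Definition proj_map (T : H -> set H) : subvs_of Hs -> set (subvs_of Hs) :=
  fun zs => [set ws | exists zss : subvs_of Hss, T (recompose zs zss) (recompose ws 0)].

Definition compl_map (T : H -> set H) :
    subvs_of Hs -> subvs_of Hs -> set (subvs_of Hss) :=
  fun zs ws => [set zss | T (recompose zs zss) (recompose ws 0)].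

End Splitting.

Arguments proj_map {R H} Hs Hss T zs _.
Arguments compl_map {R H} Hs Hss T zs ws _.

(* [B] restricted to [Hs]; [vsproj Hs] only retypes [B u], which lies in [Hs]
   when [limg B = Hs]. *)
Definition restr_op (R : realType) (H : vectType R) (Hs : {vspace H})
    (B : 'End(H)) : 'End(subvs_of Hs) :=
  linfun (vsproj Hs \o B \o vsval).

(* Main.v *)
(* Since [B] kills [Hss] and maps into [Hs], [c^-1 B (z - x)] is the vector
   [(c^-1 Bs (zs - xs), 0)]. Each inclusion pins down the witness it quantifies
   over, so (a) and the completion relation both say that [T z] contains
   [- (c^-1 B (z - x))], and [zss] then witnesses the active relation. The
   resolvent forms follow by solving an affine equation, as [Bs] is bijective:
   a kernel element lies in [Hs] and in [Hss]. *)
Require Import Defs.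
From mathcomp Require Import all_boot all_order all_algebra.
From mathcomp Require Import all_classical reals.

Import Order.TTheory GRing.Theory Num.Theory.

Local Open Scope classical_set_scope.
Local Open Scope ring_scope.

Lemma image_can2P (U V : Type) (f : U -> V) (g : V -> U) (A : set U) (v : V) :
  cancel f g -> cancel g f -> [set f w | w in A] v <-> A (g v).
Proof.
move=> fK gK; split=> [[w Aw <-]|Agv]; first by rewrite fK.
by exists (g v); [|rewrite gK].
Qed.

Lemma in_translate0 (V : zmodType) (A : set V) (a : V) :
  [set w + a | w in A] 0 <-> A (- a).
Proof.
have := @image_can2P _ _ _ (fun v => v - a) A 0 (addrK a) (subrK a).
by rewrite sub0r.
Qed.

(** The equation [v = u + c *: f w] has the unique solution [w = c^-1 *: g (v - u)]. Both resolvent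
    forms are instances of it. *)
Lemma in_affine_image (F : fieldType) (U V : lmodType F) (A : set U)
    (f : {linear U -> V}) (g : {linear V -> U}) (c : F) (u v : V) :
  c != 0 -> cancel f g -> cancel g f ->
  [set u + c *: f w | w in A] v <-> A (- (c^-1 *: g (u - v))).
Proof.
move=> c0 fK gK.
have -> : - (c^-1 *: g (u - v)) = c^-1 *: g (v - u).
  by rewrite -scalerN -linearN opprB.
apply: (@image_can2P _ _ _ (fun v => c^-1 *: g (v - u))) => w.
  by rewrite addrAC subrr add0r linearZ /= scalerA mulVf // scale1r fK.
by rewrite [f _]linearZ /= scalerA divff // scale1r gK addrC subrK.
Qed.

Section Splitting.
Variables (R : realType) (H : vectType R) (dot : {dot H for idfun}).
Variables (Hs Hss : {vspace H}).
Hypothesis split : orth_splitting dot Hs Hss.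

(** A common vector is orthogonal to itself, which contradicts definiteness unless it is zero. *)
Lemma orth_splitting_capv : (Hs :&: Hss = 0)%VS.
Proof.
have [_ /orthovP orth] := split.
apply/eqP; rewrite -subv0; apply/subvP => v.
rewrite memv_cap memv0 => /andP[vs vss]; apply/negPn/negP => v0.
by have := neq0_dnorm_gt0 (s := dot) v v0; rewrite orth ?ltxx.
Qed.

Lemma vsval_star_part z : vsval (star_part Hs Hss z) = daddv_pi Hs Hss z.
Proof. by rewrite vsprojK ?memv_pi. Qed.

Lemma vsval_sstar_part z : vsval (sstar_part Hs Hss z) = daddv_pi Hss Hs z.
Proof. by rewrite vsprojK ?memv_pi. Qed.

Lemma recompose_parts z :
  recompose (star_part Hs Hss z) (sstar_part Hs Hss z) = z.
Proof.
have [sumE _] := split.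
rewrite /recompose vsval_star_part vsval_sstar_part daddv_pi_add ?sumE ?memvf //.
exact: orth_splitting_capv.
Qed.

Variable B : 'End(H).
Hypothesis alignedB : aligned dot Hs Hss B.

Lemma vsval_restr_op u : vsval (restr_op Hs B u) = B (vsval u).
Proof.
have [_ _ imgB _] := alignedB.
have BuHs : B (vsval u) \in Hs by have := memv_img B (memvf (vsval u)); rewrite imgB.
by rewrite /restr_op lfunE /= vsprojK.
Qed.

(** The vector [z] differs from its [Hs] component by an element of [Hss], the kernel of [B]. *)
Lemma aligned_star_part z : B (vsval (star_part Hs Hss z)) = B z.
Proof.
have [_ _ _ kerB] := alignedB.
rewrite -[in RHS](recompose_parts z) linearD /=.
have : vsval (sstar_part Hs Hss z) \in lker B by rewrite kerB subvsP.
by rewrite memv_ker => /eqP ->; rewrite addr0.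
Qed.

(** This is what makes the inverse of [restr_op Hs B] in the active resolvent a genuine one. *)
Lemma lker_restr_op : lker (restr_op Hs B) == 0%VS.
Proof.
have [_ _ _ kerB] := alignedB.
rewrite -subv0; apply/subvP => u; rewrite memv_ker memv0 => /eqP Bu0.
have : vsval u \in (Hs :&: Hss)%VS.
  have : vsval u \in lker B by rewrite memv_ker -vsval_restr_op Bu0 linear0.
  by rewrite memv_cap subvsP kerB.
rewrite orth_splitting_capv memv0 -(linear0 (vsval (U := Hs))).
by move=> /eqP /val_inj ->.
Qed.

(** With [a = c^-1], this carries the argument of the completion mapping from [Hs] back to the full
    space. *)
Lemma recompose_restr_op (a : R) z x :
  recompose (- (a *: restr_op Hs B (star_part Hs Hss z - star_part Hs Hss x)))
    (0 : subvs_of Hss) = - (a *: B (z - x)).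
Proof.
rewrite /recompose linear0 addr0 linearN linearZ /= vsval_restr_op scalerN.
by congr (- (_ *: _)); rewrite !linearB /= !aligned_star_part.
Qed.

End Splitting.

Arguments recompose_parts {R H dot Hs Hss} split z.
Arguments lker_restr_op {R H dot Hs Hss} split {B} alignedB.
Arguments recompose_restr_op {R H dot Hs Hss} split {B} alignedB a z x.

Theorem theorem2p2 (R : realType) (H : vectType R) (dot : {dot H for idfun})
    (Hs Hss : {vspace H}) (T : H -> set H) (c : R) (B : 'End(H)) :
  orth_splitting dot Hs Hss ->
  monotone_map dot T ->
  0 < c ->
  aligned dot Hs Hss B ->
  forall z x : H,
  let Ts := proj_map Hs Hss T in
  let Tss := compl_map Hs Hss T in
  let Bs := restr_op Hs B in
  let zs := star_part Hs Hss z in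
  let zss := sstar_part Hs Hss z in
  let xs := star_part Hs Hss x in
  let full_incl := [set w + c^-1 *: B (z - x) | w in T z] 0 in
  let full_resolvent :=
    graph_inv (fun y => [set B y + c *: w | w in T y]) (B x) z in
  let active_incl := [set w + c^-1 *: Bs (zs - xs) | w in Ts zs] 0 in
  let completion_incl := Tss zs (- (c^-1 *: Bs (zs - xs))) zss in
  let active_resolvent :=
    graph_inv (fun y => [set y + c *: (Bs^-1)%VF w | w in Ts y]) xs zs in
  [/\ full_incl <-> full_resolvent,
      full_incl <-> active_incl /\ completion_incl &
      active_incl <-> active_resolvent].
Proof.
move=> split _ c_gt0 alignedB z x Ts Tss Bs zs zss xs full_incl full_resolvent
  active_incl completion_incl active_resolvent.
have c_neq0 : c != 0 by rewrite gt_eqF.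
have kerBs : lker Bs == 0%VS := lker_restr_op split alignedB.
have fullE : full_incl <-> T z (- (c^-1 *: B (z - x))) := in_translate0 _ _ _.
have activeE : active_incl <-> Ts zs (- (c^-1 *: Bs (zs - xs))) :=
  in_translate0 _ _ _.
have completionE : completion_incl <-> T z (- (c^-1 *: B (z - x))).
  rewrite /completion_incl /Tss /compl_map /= (recompose_parts split).
  by rewrite (recompose_restr_op split alignedB).
split.
(* Splitting [B (z - x)] exposes the difference [u - v] with [u = B z] and [v = B x]; here [f] and
   [g] are both the identity. *)
- apply: (iff_trans fullE); rewrite linearB; apply: iff_sym.
  exact: (in_affine_image _ _ _ _ idfun idfun).
- split=> [/fullE Tz|[_ /completionE /fullE //]].
  have compl : completion_incl by apply/completionE.
  (* For the witness [zss], membership in [Ts zs] unfolds to [compl]. *)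
  by split=> //; apply/activeE; exists zss.
- apply: (iff_trans activeE); apply: iff_sym.
  (* Here [u = zs] and [v = xs]. An injective endomorphism in finite dimension is bijective, so both
     cancellation laws follow from [kerBs]. *)
  apply: (in_affine_image _ _ _ _ (Bs^-1)%VF Bs) => //.
    exact: lker0_lfunVK.
  exact: lker0_lfunK.
Qed.
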